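(* Let $X\subset Y\subset Z$ be real Banach spaces, each a closed subspace of the next. If the pair $(X,Y)$ has the Daugavet property, then there is an equivalent norm $|||\cdot|||$ on $Z$ which coincides with the original norm on $Y$ and such that the pair $(X,(Z,|||\cdot|||))$ has the Daugavet property.
   Context: If $X$ is a closed subspace of a Banach space $Y$ with inclusion $J:X\to Y$, the pair $(X,Y)$ has the Daugavet property if every bounded linear operator $T:X\to Y$ of rank one satisfies $\|J+T\|=1+\|T\|$. *)

(* Defs.v *)
From HB Require Import structures.
From mathcomp Require Import all_boot all_order all_algebra.
From mathcomp Require Import all_classical all_reals all_analysis.
Set Implicit Arguments. Unset Strict Implicit. Unset Printing Implicit Defensive.
Import Order.TTheory GRing.Theory Num.Theory.
Import numFieldNormedType.Exports.
Local Open Scope classical_set_scope.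
Local Open Scope ring_scope.

Section Daugavet.
Context {R : realType} {Z : normedModType R}.

Definition is_subspace (S : set Z) : Prop :=
  S 0 /\ forall (a : R) (x y : Z), S x -> S y -> S (a *: x + y).

Definition closed_subspace (S : set Z) : Prop := is_subspace S /\ closed S.

Definition linear_on (X : set Z) (f : Z -> Z) : Prop :=
  forall (a : R) (x y : Z), X x -> X y -> f (a *: x + y) = a *: f x + f y.

Definition bounded_on (N : Z -> R) (X : set Z) (f : Z -> Z) : Prop :=
  exists M : R, forall x, X x -> N (f x) <= M * N x.

Definition rank_one_on (X : set Z) (f : Z -> Z) : Prop :=
  exists y0 : Z, y0 != 0 /\ (forall x, X x -> exists c : R, f x = c *: y0)
                 /\ exists x, X x /\ f x != 0.

Definition opnorm (N : Z -> R) (X : set Z) (f : Z -> Z) : R :=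
  sup [set N (f x) | x in X `&` [set x | N x <= 1]].

Definition daugavet_pair (N : Z -> R) (X Y : set Z) : Prop :=
  forall T : Z -> Z, linear_on X T -> bounded_on N X T ->
    (forall x, X x -> Y (T x)) -> rank_one_on X T ->
    opnorm N X (fun x => x + T x) = 1 + opnorm N X T.

Definition is_norm (nn : Z -> R) : Prop :=
  (forall z, 0 <= nn z) /\ (forall z, nn z = 0 -> z = 0) /\
  (forall (a : R) z, nn (a *: z) = `|a| * nn z) /\
  (forall x y, nn (x + y) <= nn x + nn y).

Definition equiv_norm (nn : Z -> R) : Prop :=
  exists c C : R, 0 < c /\ 0 < C /\
    forall z, c * `|z| <= nn z /\ nn z <= C * `|z|.

End Daugavet.

(* Main.v *)
(** The Daugavet property of (X, Y) means that for every slice S of the unit ball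
of X and every y in Y, the supremum of |x + y| over x in S is 1 + |y|.
Choose, by Zorn's lemma, a minimal p among the sublinear functionals on Z that
are bounded above by the norm and agree with it on Y. For a slice S put
g(z) = sup_(x in S) p(x + z) - 1; then q(z) = inf_(t > 0) g(t z) / t is again
sublinear, q <= g <= p, and q is still the norm on Y, so q = p by minimality.
Hence sup_(x in S) p(x + z) = 1 + p(z) for all z in Z. Adding the distance to Y,
which is unchanged by translations along X, to p and symmetrizing the sum gives
the required norm; symmetrization is harmless because -S is also a slice. *)
Require Import Defs.
From HB Require Import structures.
From mathcomp Require Import all_boot all_order all_algebra.
From mathcomp Require Import all_classical all_reals all_analysis.
From mathcomp Require Import ring lra.
Import Order.TTheory GRing.Theory Num.Theory.
Import numFieldNormedType.Exports.
Local Open Scope classical_set_scope.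
Local Open Scope ring_scope.

(** * Norms, subspaces and operator norms *)

Section NormBasics.
Context {R : realType} {Z : normedModType R}.
Implicit Types (N : Z -> R) (X : set Z) (x y z : Z).

Lemma norm0 N : is_norm N -> N 0 = 0.
Proof. by move=> [_ [_ [Nh _]]]; rewrite -(scale0r 0) Nh normr0 mul0r. Qed.

Lemma normN N x : is_norm N -> N (- x) = N x.
Proof. by move=> [_ [_ [Nh _]]]; rewrite -scaleN1r Nh normrN normr1 mul1r. Qed.

Lemma is_norm_normr : is_norm (fun z : Z => `|z|).
Proof.
split; first by [].
split; first by move=> z /eqP; rewrite normr_eq0 => /eqP.
by split => [a z|x y]; [exact: normrZ|exact: ler_normD].
Qed.

Lemma subspaceZ X (a : R) x : is_subspace X -> X x -> X (a *: x).
Proof. by move=> [X0 XD] Xx; rewrite -[_ *: _]addr0; exact: XD. Qed.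

Lemma subspaceD X x y : is_subspace X -> X x -> X y -> X (x + y).
Proof. by move=> [X0 XD] Xx Xy; rewrite -[x]scale1r; exact: XD. Qed.

Lemma linear_on0 X (T : Z -> Z) : is_subspace X -> linear_on X T -> T 0 = 0.
Proof.
move=> [X0 _] Tl; have := Tl 1 0 0 X0 X0.
by rewrite !scale1r addr0 => /eqP; rewrite addrC -subr_eq subrr => /eqP.
Qed.

Lemma linear_onZ X (T : Z -> Z) (a : R) x : is_subspace X -> linear_on X T ->
  X x -> T (a *: x) = a *: T x.
Proof.
move=> Xs Tl Xx; have := Tl a x 0 Xx Xs.1.
by rewrite (linear_on0 _ _ Xs Tl) !addr0.
Qed.

Lemma bounded_ball N X (T : Z -> Z) : is_norm N -> is_subspace X ->
  bounded_on N X T -> has_sup [set N (T x) | x in X `&` [set x | N x <= 1]].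
Proof.
move=> Nn Xs [M TM]; split.
  by exists (N (T 0)), 0 => //; split; [exact: Xs.1|rewrite /= norm0].
exists `|M| => _ [x [Xx /= Nx] <-]; apply: le_trans (TM _ Xx) _.
have := ler_norm M; have := normr_ge0 M; have := Nn.1 x; nra.
Qed.

Lemma opnorm_bound N X (T : Z -> Z) x : is_norm N -> is_subspace X ->
  linear_on X T -> bounded_on N X T -> X x -> N (T x) <= opnorm N X T * N x.
Proof.
move=> Nn Xs Tl Tb Xx; case: (Nn) => N0 [Nz [Nh Na]].
have [Nx0|Nx0] := eqVneq (N x) 0.
  by rewrite (Nz _ Nx0) (linear_on0 _ _ Xs Tl) norm0 // mulr0.
have Nxgt : 0 < N x by rewrite lt_def Nx0 N0.
rewrite -ler_pdivrMr //.
have -> : N (T x) / N x = N (T ((N x)^-1 *: x)).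
  by rewrite (linear_onZ _ _ _ _ Xs Tl Xx) Nh ger0_norm ?invr_ge0 // mulrC.
apply: ub_le_sup; first exact: (bounded_ball _ _ _ Nn Xs Tb).2.
exists ((N x)^-1 *: x) => //; split; first exact: subspaceZ.
by rewrite /= Nh ger0_norm ?invr_ge0 // mulVf.
Qed.

End NormBasics.

(** * Slices and the Daugavet property *)

Section Slices.
Context {R : realType} {Z : normedModType R}.
Implicit Types (N : Z -> R) (X Y : set Z) (f : Z -> R).

(** These are the norm-one functionals on [X]. The last clause can omit the absolute value since [f]
    is odd on a subspace, and it makes every slice nonempty. *)
Definition unit_functional N X f : Prop :=
  [/\ forall (a : R) x y, X x -> X y -> f (a *: x + y) = a * f x + f y,
      forall x, X x -> `|f x| <= N x
    & forall e : R, 0 < e -> exists x, [/\ X x, N x <= 1 & 1 - e < f x]].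

Definition slice N X f (e : R) : set Z :=
  [set x | [/\ X x, N x <= 1 & 1 - e < f x]].

Definition slice_property N X Y : Prop :=
  forall f, unit_functional N X f -> forall e : R, 0 < e -> forall y, Y y ->
    exists2 x, slice N X f e x & 1 + N y - e < N (x + y).

Lemma unit_functionalN N X f x : is_subspace X -> unit_functional N X f ->
  X x -> f (- x) = - f x.
Proof.
move=> Xs [fl _ _] Xx; have := fl (-1) x x Xx Xx.
rewrite scaleN1r addNr mulN1r addNr => f0.
by have := fl (-1) x 0 Xx Xs.1; rewrite f0 scaleN1r !addr0 mulN1r.
Qed.

Lemma unit_functional_opp N X f : is_norm N -> is_subspace X ->
  unit_functional N X f -> unit_functional N X (fun x => - f x).
Proof.
move=> Nn Xs fu; case: (fu) => fl fb fs; split=> [a x y Xx Xy|x Xx|e e0].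
- by rewrite fl // opprD mulrN.
- by rewrite normrN fb.
have [x [Xx Nx fx]] := fs e e0; exists (- x).
rewrite (unit_functionalN _ _ _ _ Xs fu Xx) opprK (normN N) //; split=> //.
by rewrite -scaleN1r; exact: subspaceZ.
Qed.

(** Test the property on [T x = f x *: y], of norm [N y]. A unit vector almost norming the identity
    plus [T] must, up to sign, have [f] close to 1, so [y] may replace [T x]. *)
Lemma daugavet_slice_property N X Y : is_norm N -> is_subspace X ->
  is_subspace Y -> daugavet_pair N X Y -> slice_property N X Y.
Proof.
move=> Nn Xs Ys D f fu e e0 y Yy; case: (Nn) => N0 [Nz [Nh Na]].
case: (fu) => fl fb fs.
have [->|y0] := eqVneq y 0.
  have [x [Xx Nx fx]] := fs _ e0; exists x => //.
  rewrite norm0 // !addr0; apply: lt_le_trans fx _.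
  exact: le_trans (ler_norm _) (fb _ Xx).
have Ny : 0 < N y.
  by rewrite lt_def N0 andbT; apply: contraNneq y0 => /Nz ->.
pose T x := f x *: y.
have Tl : linear_on X T.
  by move=> a u v Xu Xv; rewrite /T fl // scalerDl scalerA.
have Tb : bounded_on N X T.
  by exists (N y) => x Xx; rewrite /T Nh mulrC ler_wpM2l // fb.
have TY x : X x -> Y (T x) by move=> _; exact: subspaceZ.
have Tr : rank_one_on X T.
  exists y; split=> //; split; first by move=> x _; exists (f x).
  have [x [Xx _ fx]] := fs 1 ltr01; exists x; split=> //.
  by rewrite scaler_eq0 (negPf y0) orbF; apply: lt0r_neq0; lra.
have ge : N y <= opnorm N X T.
  rewrite leNgt; apply/negP => lt.
  have [|x [Xx Nx fx]] := fs (1 - opnorm N X T / N y).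
    by rewrite subr_gt0 ltr_pdivrMr // mul1r.
  have : N (T x) <= opnorm N X T.
    apply: ub_le_sup; last by exists x.
    exact: (bounded_ball _ _ _ Nn Xs Tb).2.
  rewrite Nh; apply/negP; rewrite -ltNge -ltr_pdivrMr //.
  by apply: lt_le_trans (ler_norm _); lra.
have IT := D T Tl Tb TY Tr.
have ITb : bounded_on N X (fun x => x + T x).
  exists (1 + N y) => x Xx; apply: le_trans (Na _ _) _.
  rewrite mulrDl mul1r lerD2l /T Nh mulrC ler_wpM2l //; exact: fb.
(* Near-norming yields [(1 - f u) * N y < d]. The first bound on [d] then puts [u] in the slice; the
   second pays for two losses of [d], one from near-norming and one from replacing [f u *: y] by
   [y]. *)
pose d := Num.min (e * N y) (e / 2).
have d0 : 0 < d by rewrite lt_min; apply/andP; split; [exact: mulr_gt0|lra].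
have [_ [x [Xx /= Nx] <-]] := sup_adherent d0 (bounded_ball _ _ _ Nn Xs ITb).
rewrite -[sup _]/(opnorm N X _) IT => big.
have {ge}big : 1 + N y - d < N (x + T x) by apply: le_lt_trans big; lra.
have [u [Xu Nu fu0 bigu]] :
    exists u, [/\ X u, N u <= 1, 0 <= f u & 1 + N y - d < N (u + f u *: y)].
  have [fx|fx] := leP 0 (f x); first by exists x.
  exists (- x); rewrite normN // (unit_functionalN _ _ _ _ Xs fu Xx).
  split=> //; first by rewrite -scaleN1r; exact: subspaceZ.
  - by lra.
  - by rewrite scaleNr -opprD (normN N).
have d1 : d <= e * N y by rewrite /d ge_min lexx.
have d2 : d <= e / 2 by rewrite /d ge_min lexx orbT.
have fu1 : f u <= 1.
  by apply: le_trans (ler_norm _) _; apply: le_trans (fb _ Xu) Nu.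
have h1 := Na u (f u *: y); rewrite Nh ger0_norm // in h1.
exists u; first by split => //; nra.
have h2 := Na (u + y) ((f u - 1) *: y).
rewrite Nh scalerBl scale1r -addrA [y + _]addrC subrK in h2.
rewrite ler0_norm ?subr_le0 // in h2; nra.
Qed.

(** Factor [T] as [f x *: z] with [N z] equal to its operator norm; then [f] has norm one, and on a
    thin slice of [f] the vector [T x] is close to [z]. *)
Lemma slice_property_daugavet N X : is_norm N -> is_subspace X ->
  slice_property N X setT -> daugavet_pair N X setT.
Proof.
move=> Nn Xs sp T Tl Tb _ [y0 [y00 [Ty [x0 [Xx0 Tx0]]]]].
case: (Nn) => N0 [Nz [Nh Na]].
have Npos z : z != 0 -> 0 < N z.
  by move=> z0; rewrite lt_def N0 andbT; apply: contraNneq z0 => /Nz ->.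
set s := opnorm N X T.
have Ts x : X x -> N (T x) <= s * N x by exact: opnorm_bound.
have s0 : 0 < s.
  have := lt_le_trans (Npos _ Tx0) (Ts _ Xx0); have := N0 x0; nra.
pose z := (s / N y0) *: y0.
have Nz0 : N y0 != 0 by rewrite lt0r_neq0 // Npos.
have NzE : N z = s.
  by rewrite Nh ger0_norm ?divfK // divr_ge0 // ltW.
have z0 : z != 0.
  by apply/eqP => zE; move: s0; rewrite -NzE zE norm0 // ltxx.
have /choice[f fE] : forall x, exists c, X x -> T x = c *: z.
  move=> x; have [Xx|] := pselect (X x); last by exists 0.
  have [c ->] := Ty _ Xx; exists (c * (N y0 / s)) => _.
  by rewrite scalerA; congr (_ *: _); field; rewrite Nz0 lt0r_neq0.
have NT x : X x -> N (T x) = `|f x| * s by move=> Xx; rewrite fE // Nh NzE.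
have fb x : X x -> `|f x| <= N x.
  by move=> Xx; rewrite -(ler_pM2r s0) -NT // mulrC; exact: Ts.
have fl (a : R) x y : X x -> X y -> f (a *: x + y) = a * f x + f y.
  move=> Xx Xy; apply/eqP; rewrite -subr_eq0.
  have := Tl a x y Xx Xy; rewrite !fE //; last exact: Xs.2.
  move/eqP; rewrite scalerA -scalerDl -subr_eq0 -scalerBl scaler_eq0.
  by rewrite (negPf z0) orbF.
have Tsup := bounded_ball _ _ _ Nn Xs Tb.
have fu : unit_functional N X f.
  split=> // e e0; have es0 : 0 < e * s by exact: mulr_gt0.
  have [_ [x [Xx /= Nx] <-]] := sup_adherent es0 Tsup.
  rewrite -[sup _]/s NT // => h.
  have {}h : 1 - e < `|f x| by nra.
  have [fx|fx] := leP 0 (f x); first by exists x; rewrite ger0_norm in h.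
  exists (-1 *: x); split; first exact: subspaceZ.
  - by rewrite scaleN1r normN.
  - have f0 : f 0 = 0.
      by apply/eqP; rewrite -normr_le0 -(norm0 _ Nn) fb //; exact: Xs.1.
    have := fl (-1) x 0 Xx Xs.1; rewrite addr0 f0 addr0 mulN1r => ->.
    by rewrite ltr0_norm in h.
have ITub : ubound [set N (x + T x) | x in X `&` [set x | N x <= 1]] (1 + s).
  move=> _ [x [Xx /= Nx] <-]; apply: le_trans (Na _ _) _; apply: lerD => //.
  by apply: le_trans (Ts _ Xx) _; rewrite ger_pMr.
apply/eqP; rewrite eq_le; apply/andP; split.
  apply: ge_sup => //; exists (N (0 + T 0)), 0 => //.
  by split; [exact: Xs.1|rewrite /= norm0].
apply/ler_addgt0Pr => e e0.
(* The slice property loses [d], and exchanging [z] for [T x] loses at most [d * s]; together this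
   is [e]. *)
pose d := e / (1 + s).
have d0 : 0 < d by rewrite divr_gt0 // addr_gt0.
have de : d * (1 + s) = e by rewrite divfK // lt0r_neq0 // addr_gt0.
have [x [Xx Nx fx] xz] := sp f fu d d0 z I.
have fx1 : f x <= 1.
  by apply: le_trans (ler_norm _) _; apply: le_trans (fb _ Xx) Nx.
have : N (x + T x) <= opnorm N X (fun x => x + T x).
  by apply: ub_le_sup; [exists (1 + s)|exists x].
have h := Na (x + T x) ((1 - f x) *: z).
rewrite Nh NzE scalerBl scale1r ger0_norm ?subr_ge0 // in h.
rewrite -addrA {1}(fE _ Xx) [f x *: z + _]addrC subrK in h.
rewrite NzE in xz; nra.
Qed.

End Slices.

(** * Sublinear functionals, infima and symmetrization *)

Section Sublinear.
Context {R : realType} {Z : normedModType R}.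
Implicit Types (p q : Z -> R) (X Y S : set Z).

Definition sublinear p : Prop :=
  (forall (a : R) z, 0 < a -> p (a *: z) <= a * p z) /\
  (forall x y, p (x + y) <= p x + p y).

Lemma sublinear_ge0 p z : sublinear p -> 0 <= p z + p (- z).
Proof.
move=> [_ pa]; have := pa 0 0; rewrite addr0.
by have := pa z (- z); rewrite subrr; lra.
Qed.

Lemma sublinear_ge_norm p z : sublinear p -> (forall x, p x <= `|x|) ->
  - `|z| <= p z.
Proof.
move=> ps pn; have := pn (- z); rewrite normrN.
by have := sublinear_ge0 _ z ps; lra.
Qed.

(** Common source of sublinearity for the infimum of a chain of functionals, for the functional q,
    and for the distance to a subspace. *)
Lemma inf_sublinear (A : Z -> set R) :
  (forall z, A z !=set0) -> (forall z, has_lbound (A z)) ->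
  (forall (a : R) z s, 0 < a -> A z s ->
    exists2 u, A (a *: z) u & u <= a * s) ->
  (forall x y s t, A x s -> A y t -> exists2 u, A (x + y) u & u <= s + t) ->
  sublinear (fun z => inf (A z)).
Proof.
move=> A0 Alb Ah Aa; split=> [a z a0|x y].
  rewrite -ler_pdivrMl //; apply: lb_le_inf => // s As.
  have [u Au us] := Ah _ _ _ a0 As.
  by rewrite ler_pdivrMl //; apply: le_trans us; exact: ge_inf.
rewrite -lerBlDr; apply: lb_le_inf => // s As.
rewrite lerBlDr [s + _]addrC -lerBlDr; apply: lb_le_inf => // t At.
have [u Au us] := Aa _ _ _ _ As At.
by rewrite lerBlDr [t + s]addrC; apply: le_trans us; exact: ge_inf.
Qed.

(** Using the inverse scalar turns the inequality in [sublinear] into positive homogeneity; the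
    maximum over [z] and [- z] handles negative scalars. *)
Lemma sublinear_max_norm p : sublinear p ->
  (forall z, Num.max (p z) (p (- z)) = 0 -> z = 0) ->
  is_norm (fun z => Num.max (p z) (p (- z))).
Proof.
move=> [ph pa] pz; have ps : sublinear p by [].
have phE (a : R) z : 0 < a -> p (a *: z) = a * p z.
  move=> a0; apply/eqP; rewrite eq_le ph //= -ler_pdivlMl //.
  have ai : 0 < a^-1 by rewrite invr_gt0.
  by have := ph a^-1 (a *: z) ai; rewrite scalerA mulVf ?lt0r_neq0 // scale1r.
have nng z : 0 <= Num.max (p z) (p (- z)).
  have := sublinear_ge0 _ z ps; rewrite le_max.
  by have [//|] := leP 0 (p z); lra.
split=> //; split=> //; split=> [a z|x y]; last first.
  rewrite ge_max opprD; apply/andP; split; apply: le_trans (pa _ _) _;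
    by apply: lerD; rewrite le_max lexx ?orbT.
have hpos (b : R) w : 0 < b ->
    Num.max (p (b *: w)) (p (- (b *: w))) = b * Num.max (p w) (p (- w)).
  by move=> b0; rewrite -scalerN !phE // maxr_pMr // ltW.
have [a0|a0|->] := ltgtP a 0.
- by rewrite ltr0_norm // -hpos ?oppr_gt0 // scaleNr opprK maxC.
- by rewrite gtr0_norm // hpos.
have p0 : p 0 = 0.
  have := phE 2 0 (ltr0Sn _ 1); rewrite scaler0; lra.
by rewrite scale0r normr0 mul0r oppr0 p0 maxxx.
Qed.

(** * Minimal sublinear functionals extending the norm of [Y] *)

Definition sublinear_between Y p : Prop :=
  [/\ sublinear p, forall z, p z <= `|z| & forall y, Y y -> `|y| <= p y].

Lemma minimal_sublinear_between Y : exists p, sublinear_between Y p /\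
  forall q, sublinear_between Y q -> (forall z, q z <= p z) ->
    forall z, p z <= q z.
Proof.
have n_btw : sublinear_between Y (fun z => `|z|).
  split=> //; split=> [a z a0|]; last exact: ler_normD.
  by rewrite normrZ gtr0_norm.
pose T := {p : Z -> R | sublinear_between Y p}.
(* The order is reversed, so that the maximal element given by Zorn's lemma is a minimal
   functional. *)
pose le (p q : T) := `[< forall z, sval q z <= sval p z >].
have [|||p pmin] := @ZL_preorder T (exist _ _ n_btw) le.
- by move=> p; apply/asboolP.
- move=> p q r /asboolP h1 /asboolP h2; apply/asboolP => z.
  exact: le_trans (h2 z) (h1 z).
- move=> C Ctot.
  have [->|/set0P[p0 Cp0]] := eqVneq C set0.
    by exists (exist _ _ n_btw).
  pose A z := [set sval p z | p in C].
  have A0 z : A z !=set0 by exists (sval p0 z), p0.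
  have Alb z : has_lbound (A z).
    exists (- `|z|) => _ [p Cp <-].
    by have [ps pn _] := svalP p; exact: sublinear_ge_norm.
  have inf_btw : sublinear_between Y (fun z => inf (A z)).
    split=> [|z|y Yy].
    + apply: inf_sublinear => // [a z _ a0 [p Cp <-]|x y _ _ [p Cp <-] [q Cq <-]].
        have [[ph _] _ _] := svalP p.
        by exists (sval p (a *: z)); [exists p|exact: ph].
      (* Two members of the chain are comparable, and the smaller one, [q], serves for the sum:
         [q (x + y) <= q x + q y <= p x + q y]. *)
      wlog /asboolP pq : p q x y Cp Cq / le p q => [hw|].
        have [/hw|/hw] := Ctot _ _ Cp Cq; first exact.
        by move=> /(_ y x Cq Cp); rewrite addrC [sval q y + _]addrC.
      have [[_ qa] _ _] := svalP q.
      exists (sval q (x + y)); first by exists q.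
      by apply: le_trans (qa _ _) _; rewrite lerD2r.
    + have [_ pn _] := svalP p0; apply: le_trans (pn z).
      by apply: ge_inf => //; exists p0.
    + apply: lb_le_inf => // _ [p Cp <-].
      by have [_ _ pY] := svalP p; exact: pY.
  exists (exist _ _ inf_btw) => p Cp; apply/asboolP => z /=.
  by apply: ge_inf => //; exists p.
exists (sval p); split; first exact: svalP.
move=> q qb qp; apply/asboolP; apply: (pmin (exist _ _ qb)).
exact/asboolP.
Qed.

Definition daugavet_set Y p S : Prop :=
  forall e : R, 0 < e -> forall y, Y y -> exists2 x, S x & 1 + p y - e < p (x + y).

Lemma minimal_daugavet_set Y p S : is_subspace Y -> sublinear_between Y p ->
  (forall q, sublinear_between Y q -> (forall z, q z <= p z) ->
    forall z, p z <= q z) ->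
  S `<=` Y -> (forall x, S x -> `|x| <= 1) ->
  daugavet_set Y (fun z => `|z|) S -> daugavet_set setT p S.
Proof.
move=> Ys pb pmin SY S1 DS e e0 z _; case: (pb) => ps pn pY.
case: (ps) => ph pa.
(* [inf (A w)] is q(w): the condition on [s] says that g(t w) / t <= s. *)
pose A w := [set s : R | exists2 t : R, 0 < t &
  forall x, S x -> p (x + t *: w) <= 1 + t * s].
have Ap w : A w (p w).
  exists 1 => // x Sx; rewrite scale1r mul1r; apply: le_trans (pa _ _) _.
  by rewrite lerD2r; apply: le_trans (pn x) (S1 _ Sx).
(* Since [S] lies in [Y], [p] dominates the norm at [x + t *: y], and some [x] in [S] brings that
   norm near [1 + t * |y|]. *)
have AY y s : Y y -> A y s -> `|y| <= s.
  move=> Yy [t t0 ts]; rewrite -(ler_pM2l t0); apply/ler_addgt0Pr => d d0.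
  have tyY : Y (t *: y) by exact: subspaceZ.
  have [x Sx xy] := DS d d0 _ tyY.
  have := ts x Sx; have := pY _ (subspaceD _ _ _ Ys (SY _ Sx) tyY).
  by rewrite normrZ gtr0_norm // in xy; lra.
(* The case [y = 0] of [DS] gives [x] in [S] of norm near 1; compare [p x] with
   [p (x + t *: w) + p (- (t *: w))]. *)
have Alb w : lbound (A w) (- `|w|).
  move=> s [t t0 ts]; rewrite -(ler_pM2l t0); apply/ler_addgt0Pr => d d0.
  have [x Sx xy] := DS d d0 0 Ys.1; rewrite normr0 !addr0 in xy.
  have := ts x Sx; have := pa (x + t *: w) (t *: - w).
  rewrite scalerN addrK => h1; have := pY x (SY _ Sx).
  have := ph t (- w) t0; have := pn (- w); rewrite normrN scalerN; nra.
have qb : sublinear_between Y (fun w => inf (A w)).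
  split=> [|w|y Yy].
  - apply: inf_sublinear => [w|w|a w s a0 [t t0 ts]|v w s s' [t t0 ts] [t' t0' ts']].
    + by exists (p w).
    + by exists (- `|w|).
    + exists (a * s) => //; exists (t / a); first exact: divr_gt0.
      move=> x Sx; rewrite scalerA mulrA divfK ?lt0r_neq0 //; exact: ts.
    + exists (s + s') => //; pose r := t + t'.
      have r0 : 0 < r by exact: addr_gt0.
      exists (t * t' / r); first by rewrite divr_gt0 // mulr_gt0.
      move=> x Sx.
      (* Convexity of g, with weights chosen so that the two scales t and t'
         become the common scale t t' / (t + t'). *)
      have -> : x + (t * t' / r) *: (v + w) =
          (t' / r) *: (x + t *: v) + (t / r) *: (x + t' *: w).
        rewrite !scalerDr !scalerA addrACA -scalerDl -mulrDl [t' + t]addrC.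
        by rewrite divff ?lt0r_neq0 // scale1r; congr (_ + (_ *: _ + _ *: _)); ring.
      apply: le_trans (pa _ _) _.
      have tr : 0 < t / r by exact: divr_gt0.
      have tr' : 0 < t' / r by exact: divr_gt0.
      have h1 := ph _ (x + t *: v) tr'; have h2 := ph _ (x + t' *: w) tr.
      have g1 := ler_wpM2l (ltW tr') (ts _ Sx).
      have g2 := ler_wpM2l (ltW tr) (ts' _ Sx).
      have -> : 1 + t * t' / r * (s + s') =
          t' / r * (1 + t * s) + t / r * (1 + t' * s').
        by rewrite /r; field; rewrite lt0r_neq0.
      by lra.
  - apply: le_trans (pn w); apply: ge_inf => //; by exists (- `|w|).
  - apply: lb_le_inf; first by exists (p y).
    by move=> s; exact: AY.
have qp w : inf (A w) <= p w by apply: ge_inf => //; exists (- `|w|).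
have [//|no] := pselect (exists2 x, S x & 1 + p z - e < p (x + z)).
(* If no [x] in [S] works, scale [t = 1] admits [p z - e], so q drops strictly below [p] at [z],
   against minimality. *)
have : A z (p z - e).
  exists 1 => // x Sx; rewrite scale1r mul1r addrA leNgt.
  by apply/negP => lt; apply: no; exists x.
move=> Ae; have := pmin _ qb qp z.
have : inf (A z) <= p z - e by apply: ge_inf => //; exists (- `|z|).
lra.
Qed.

(** * Distance to a subspace *)

Definition dist_to Y z : R := inf [set `|z - y| | y in Y].

Lemma dist_toE Y z :
  is_subspace Y -> lbound [set `|z - y| | y in Y] (dist_to Y z).
Proof. by move=> Ys; apply: ge_inf; exists 0 => _ [y _ <-]. Qed.

Lemma dist_to_ge0 Y z : is_subspace Y -> 0 <= dist_to Y z.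
Proof.
move=> [Y0 _]; apply: lb_le_inf; first by exists `|z - 0|, 0.
by move=> _ [y _ <-].
Qed.

Lemma dist_to_le Y z : is_subspace Y -> dist_to Y z <= `|z|.
Proof.
move=> Ys; apply: dist_toE => //.
by exists 0; [exact: Ys.1|rewrite subr0].
Qed.

Lemma dist_to_sub Y y : is_subspace Y -> Y y -> dist_to Y y = 0.
Proof.
move=> Ys Yy; apply/eqP; rewrite eq_le dist_to_ge0 // andbT.
by apply: dist_toE => //; exists y; rewrite // subrr normr0.
Qed.

Lemma sublinear_dist_to Y : is_subspace Y -> sublinear (dist_to Y).
Proof.
move=> Ys; apply: inf_sublinear => [z|z|a z _ a0 [y Yy <-]|u v _ _ [y Yy <-] [y' Yy' <-]].
- by exists `|z - 0|, 0 => //; exact: Ys.1.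
- by exists 0 => _ [y _ <-].
- exists `|a *: z - a *: y|; first by exists (a *: y) => //; exact: subspaceZ.
  by rewrite -scalerBr normrZ gtr0_norm.
- exists `|(u + v) - (y + y')|; first by exists (y + y') => //; exact: subspaceD.
  by rewrite opprD addrACA; exact: ler_normD.
Qed.

Lemma dist_toD Y x z : is_subspace Y -> Y x -> dist_to Y (x + z) = dist_to Y z.
Proof.
move=> Ys Yx; have [_ da] := sublinear_dist_to _ Ys.
have Ynx : Y (- x) by rewrite -scaleN1r; exact: subspaceZ.
apply/eqP; rewrite eq_le; apply/andP; split.
  by apply: le_trans (da _ _) _; rewrite dist_to_sub // add0r.
have := da (- x) (x + z); rewrite addrA addNr add0r.
by rewrite (dist_to_sub _ _ Ys Ynx) add0r.
Qed.

Lemma dist_toN Y z : is_subspace Y -> dist_to Y (- z) = dist_to Y z.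
Proof.
move=> Ys.
have le w : dist_to Y (- w) <= dist_to Y w.
  apply: lb_le_inf; first by exists `|w - 0|, 0 => //; exact: Ys.1.
  move=> _ [y Yy <-]; apply: dist_toE => //.
  exists (- y); first by rewrite -scaleN1r; exact: subspaceZ.
  by rewrite -opprD normrN.
by apply/eqP; rewrite eq_le le -{1}[z]opprK le.
Qed.

(** For [y] in [Y], the norm of [y] is at most [p y <= p z + |y - z|]; the triangle inequality adds
    a second [|z - y|], whence the factor 2. *)
Lemma norm_le_dist_to Y p z : is_subspace Y -> sublinear_between Y p ->
  `|z| <= p z + dist_to Y z *+ 2.
Proof.
move=> Ys [[ph pa] pn pY]; rewrite -lerBlDl -mulr_natr -ler_pdivrMr //.
apply: lb_le_inf; first by exists `|z - 0|, 0 => //; exact: Ys.1.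
move=> _ [y Yy <-]; rewrite ler_pdivrMr // mulr_natr mulr2n.
have := pa z (y - z); rewrite addrC subrK => h1.
have := pn (y - z); rewrite distrC => h2.
have := ler_normD (z - y) y; rewrite subrK.
have := pY y Yy; lra.
Qed.

End Sublinear.

(** * The renorming of [Z] *)

Theorem mainTheorem13 (R : realType) (Z : completeNormedModType R)
  (X Y : set Z) :
  closed_subspace X -> closed_subspace Y -> X `<=` Y ->
  daugavet_pair (fun z : Z => `|z|) X Y ->
  exists nn : Z -> R,
    is_norm nn /\ equiv_norm nn /\ (forall y, Y y -> nn y = `|y|) /\
    daugavet_pair nn X setT.
Proof.
move=> [Xs _] [Ys _] XY D.
have [p [pb pmin]] := minimal_sublinear_between Y; have [ps pn pY] := pb.
have ds := sublinear_dist_to _ Ys.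
pose P z := p z + dist_to Y z.
have Ps : sublinear P.
  split=> [a z a0|x y]; first by rewrite mulrDr lerD ?ps.1 ?ds.1.
  by rewrite addrACA lerD ?ps.2 ?ds.2.
pose nn z := Num.max (P z) (P (- z)).
have PN z : P z <= nn z by rewrite le_max lexx.
(* [P z + P (- z)] is at least twice the distance, because [p z + p (- z)] is nonnegative. *)
have dn z : dist_to Y z <= nn z.
  have := sublinear_ge0 _ z ps; have := PN z; have : P (- z) <= nn z.
    by rewrite le_max lexx orbT.
  by rewrite /P dist_toN //; lra.
have lower z : 2^-1 * `|z| <= nn z.
  have := norm_le_dist_to _ _ z Ys pb; have := PN z; have := dn z.
  rewrite /P mulr2n; lra.
have upper z : nn z <= 2 * `|z|.
  have up w : P w <= 2 * `|w|.
    by rewrite mulr_natl mulr2n lerD // dist_to_le.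
  by rewrite ge_max up /= -normrN up.
have nnn : is_norm nn.
  apply: sublinear_max_norm => // z z0; apply/eqP; rewrite -normr_le0.
  have := lower z; rewrite /nn z0; lra.
have nnY y : Y y -> nn y = `|y|.
  have PY w : Y w -> P w = `|w|.
    move=> Yw; rewrite /P dist_to_sub // addr0; apply/eqP.
    by rewrite eq_le pn pY.
  move=> Yy; rewrite /nn !PY ?normrN ?maxxx //.
  by rewrite -scaleN1r; exact: subspaceZ.
exists nn; split=> //; split.
  by exists 2^-1, 2; split=> //; rewrite ?invr_gt0.
split=> //; apply: slice_property_daugavet => // f fu e e0 z _.
(* [nn] is the original norm on [X], so both norms have the same norm-one functionals and slices
   there. *)
have {}fu : unit_functional (fun z : Z => `|z|) X f.
  case: fu => fl fb fs; split=> // [x Xx|d d0].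
    by rewrite -nnY ?fb //; exact: XY.
  have [x [Xx nx fx]] := fs d d0.
  by exists x; rewrite -nnY //; exact: XY.
have spread g w : unit_functional (fun z : Z => `|z|) X g ->
    exists2 x, slice nn X g e x & 1 + P w - e < P (x + w).
  move=> gu.
  have sp := daugavet_slice_property _ _ _ is_norm_normr Xs Ys D g gu.
  have DS : daugavet_set Y (fun z => `|z|) (slice (fun z : Z => `|z|) X g e).
    (* The slice keeps its depth [e] while the defect [d] is arbitrary; the minimum meets both
       demands. *)
    move=> d d0 y Yy; have m0 : 0 < Num.min d e by rewrite lt_min d0.
    have [x [Xx x1 gx] xy] := sp _ m0 y Yy; exists x.
      split=> //; apply: le_lt_trans gx.
      by rewrite lerD2l lerN2 ge_min lexx orbT.
    apply: le_lt_trans xy.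
    by rewrite lerD2l lerN2 ge_min lexx.
  have [||x [Xx x1 gx] xw] :=
      minimal_daugavet_set _ _ _ Ys pb pmin _ _ DS e e0 w I.
  - by move=> x [Xx _ _]; exact: XY.
  - by move=> x [].
  have Yx := XY _ Xx; exists x; first by split=> //; rewrite nnY.
  by rewrite /P (dist_toD _ _ _ Ys Yx); lra.
(* In the second case the slice of [- f] is used at [- z], and the point found is negated. *)
have [nnz|nnz] : nn z = P z \/ nn z = P (- z).
  by rewrite /nn; case: leP; [right|left].
  have [x fx xz] := spread f z fu; exists x => //.
  by rewrite nnz; exact: lt_le_trans (PN _).
have fuN := unit_functional_opp _ _ _ is_norm_normr Xs fu.
have [x [Xx x1 fx] xz] := spread _ (- z) fuN; exists (- x).
  split; first by rewrite -scaleN1r; exact: subspaceZ.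
  - by rewrite (normN nn).
  - by rewrite (unit_functionalN _ _ _ _ Xs fu Xx).
rewrite nnz; apply: lt_le_trans xz _.
by rewrite -[x + _]opprK opprD opprK le_max lexx orbT.
Qed.
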